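(* There exists a positive integer $n_0$ such that the following holds. Let $\mathcal{V}$ be a set of $n \geq n_0$ points in $\mathbb{C}^4$ such that at most $\frac{2}{3}n$ points of $\mathcal{V}$ are contained in any $3$-dimensional complex affine subspace. Then $t_2(\mathcal{V}) \geq \frac{1}{12}n^2$.
   Context: $t_2(\mathcal{V})$ denotes the number of ordinary lines of $\mathcal{V}$, i.e. complex affine lines containing exactly two points of $\mathcal{V}$. *)

(* Defs.v *)
From HB Require Import structures.
From mathcomp Require Import all_boot all_order all_algebra.
From mathcomp Require Import finmap.
From mathcomp Require Import boolp classical_sets cardinality reals.
From mathcomp Require Import complex.

Set Implicit Arguments.
Unset Strict Implicit.
Unset Printing Implicit Defensive.

Import Order.TTheory GRing.Theory Num.Theory.

Local Open Scope ring_scope.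
Local Open Scope classical_set_scope.

Section AffineIncidence.
Variables (K : fieldType) (E : vectType K).
Implicit Types (V : {fset E}) (A : set E).

Definition affine_subspace (d : nat) A : Prop :=
  exists (p : E) (W : {vspace E}), \dim W = d /\ A = [set x | x - p \in W].

Definition points_in V A : {fset E} := [fset x in V | x \in A]%fset.

Definition ordinary_lines V : set (set E) :=
  [set L | affine_subspace 1 L /\ #|` points_in V L| = 2%N].

(* fset_set returns the empty set on infinite arguments; ordinary_lines V is
   always finite, since each of its lines is determined by two points of V. *)
Definition t2 V : nat := #|` fset_set (ordinary_lines V)|.

End AffineIncidence.

(* Main.v *)
Require Import Defs.
From HB Require Import structures.
From mathcomp Require Import all_boot all_order all_algebra.
From mathcomp Require Import finmap.
From mathcomp Require Import boolp classical_sets cardinality reals.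
From mathcomp Require Import complex.
From mathcomp Require Import ring lra.
From mathcomp Require Import spectral exp.

(* Give each ordered triple of distinct collinear points of a line containing
   r points the weight 1/(r-2), so that every ordered pair of points that is
   not on an ordinary line has total weight 1. If there are few ordinary lines,
   the total weight exceeds 4/5 n^2. Let U be a subset of the points that
   maximizes weight(U)/|U|. Since weight(U) <= |U|^2, the set U has more than
   4/5 n points, hence spans the space affinely. The linear dependencies of the
   collinear triples in U are the rows of a complex matrix A that kills a
   5-dimensional space. Maximality of U is the Hall-type condition under which
   the rows and columns of A can be scaled so that all rows have norm 1 and all
   columns have nearly equal norm; the scaling is a near-minimizer of a
   Sinkhorn-type potential that the Hall condition bounds from below. For the
   scaled A, the trace and the Frobenius norm of the weighted Gram matrix force
   its rank above |U| - 5, a contradiction. *)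

Set Implicit Arguments.
Unset Strict Implicit.
Unset Printing Implicit Defensive.

Import Order.TTheory GRing.Theory Num.Theory.

Local Open Scope ring_scope.
Local Open Scope complex_scope.

(** * Hall-type condition and matrix scaling *)

(** Layer-cake argument: subtracting the bound for [A] from the total weight, the sets [S k] that
    meet the complement of [A] weigh at least [L] times its size. Summing this over the superlevel
    sets of [x] gives the inequality. *)
Lemma hall_weighted_sum_le (R : realFieldType) (J K : finType) (w : K -> R)
    (S : K -> {set J}) (L : R) :
  (forall k, 0 <= w k) ->
  \sum_k w k = L * #|J|%:R ->
  (forall A : {set J}, \sum_(k | S k \subset A) w k <= L * #|A|%:R) ->
  forall (x : J -> R) (g : K -> R),
    (forall k j, 0 < w k -> j \in S k -> x j <= g k) ->
  L * \sum_j x j <= \sum_k w k * g k.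
Proof.
move=> w0 wtot hall x g.
have S_neq0 k : 0 < w k -> exists j, j \in S k.
  move=> wk; apply/set0Pn/negP => /eqP Sk.
  have := hall finset.set0.
  rewrite cards0 mulr0 (bigD1 k) ?Sk ?finset.sub0set //=.
  by apply/negP; rewrite -ltNge ltr_pwDl ?sumr_ge0.
(* Induction on the number of indices whose value lies below an upper bound [M]; each step cuts off
   the top layer. *)
suff main m M (y : J -> R) (h : K -> R) :
    (#|[set j | (y j < M)%R]| < m)%N -> (forall j, y j <= M) ->
    (forall k j, 0 < w k -> j \in S k -> y j <= h k) ->
    L * \sum_j y j <= \sum_k w k * h k.
  move=> xg; apply: (main _ (\sum_j `|x j|) _ _ (ltnSn _)) xg => j.
  by rewrite (le_trans (ler_norm _))// (bigD1 j)//= lerDl sumr_ge0.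
elim: m => // m IHm in M y h *; rewrite ltnS => card_m yM yh.
have [A0|[j1 j1A]] := set_0Vmem [set j | y j < M].
  have yE j : y j = M.
    apply/eqP; rewrite eq_le yM leNgt; apply/negP => yj.
    by have := finset.in_set0 j; rewrite -A0 inE yj.
  under eq_bigr do rewrite yE.
  rewrite sumr_const -(mulr_natl M) mulrA -wtot mulr_suml ler_sum // => k _.
  have := w0 k; rewrite le_eqVlt => /predU1P[<-|wk]; first by rewrite !mul0r.
  by have [j jS] := S_neq0 k wk; rewrite ler_pM2l // -(yE j) yh.
have [j0 j0A j0max] : exists2 j0, y j0 < M & forall j, y j < M -> y j <= y j0.
  rewrite inE in j1A.
  case: (@arg_maxP _ _ _ j1 (fun j => y j < M) y j1A) => j0 Hj0 Hmax.
  by exists j0.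
set A := [set j | y j < M]; set M' := y j0.
(* Clipping at [M'], the largest value below [M], puts [j0] at the new bound, so fewer indices
   remain below it. *)
pose y' j := Num.min (y j) M'; pose h' k := Num.min (h k) M'.
have IH : L * \sum_j y' j <= \sum_k w k * h' k.
  apply: (IHm M') => [|j|k j wk jS].
  - apply: leq_trans card_m; apply: proper_card; apply/properP; split.
      apply/fintype.subsetP=> j.
      by rewrite !inE /y' gt_min ltxx orbF => /lt_trans; apply.
    by exists j0; rewrite !inE ?j0A // /y' gt_min !ltxx.
  - by rewrite /y' ge_min lexx orbT.
  - by rewrite /y' /h' le_min !ge_min lexx orbT yh.
have sumy : \sum_j y j = \sum_j y' j + (M - M') * #|~: A|%:R.
  rewrite mulr_natr -sumr_const [X in _ + X]big_mkcond -big_split /=.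
  apply: eq_bigr => j _; rewrite /y' !inE.
  have [yj|yj] /= := ltP (y j) M; first by rewrite addr0 min_l ?j0max.
  have -> : y j = M by apply/eqP; rewrite eq_le yM.
  by rewrite min_r 1?ltW //; ring.
have sumh : \sum_k w k * h' k + (M - M') * \sum_(k | ~~ (S k \subset A)) w k
    <= \sum_k w k * h k.
  rewrite mulr_sumr [X in _ + X]big_mkcond -big_split /= ler_sum // => k _.
  have h'h : h' k <= h k by rewrite /h' ge_min lexx.
  have [_|/subsetPn[j jS]] /= := boolP (S k \subset A).
    by rewrite addr0 ler_wpM2l.
  rewrite inE -leNgt => Mj.
  have := w0 k; rewrite le_eqVlt => /predU1P[<-|wk].
    by rewrite !(mul0r, mulr0) addr0.
  have Mh : M <= h k by apply: le_trans Mj (yh _ _ wk jS).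
  have -> : h' k = M' by rewrite /h' min_r // (le_trans (ltW j0A)).
  by rewrite [_ * w k]mulrC -mulrDr addrCA subrr addr0 ler_pM2l.
have compl : L * #|~: A|%:R <= \sum_(k | ~~ (S k \subset A)) w k.
  have := hall A; have := wtot; rewrite (bigID (fun k => S k \subset A)) /=.
  rewrite -(cardsC A) natrD; lra.
apply: le_trans sumh; rewrite sumy mulrDr lerD //.
by rewrite mulrCA ler_wpM2l // subr_ge0 ltW.
Qed.

(** The derivative of the potential [Phi] with respect to [ln (y j)] is the column sum at [j] minus
    [L]. The Hall condition bounds [Phi] from below, and at a near-minimizer this derivative cannot
    be large. *)
Lemma approximate_scaling (R : realType) (J K : finType) (w : K -> R)
    (X : K -> J -> R) (L : R) :
  0 <= L -> (forall k, 0 <= w k) -> (forall k j, 0 <= X k j) ->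
  \sum_k w k = L * #|J|%:R ->
  (forall A : {set J},
    \sum_(k | [set j | 0 < X k j] \subset A) w k <= L * #|A|%:R) ->
  forall e, 0 < e ->
  exists2 y : J -> R, (forall j, 0 < y j) &
    forall j, \sum_k w k * (X k j * y j / \sum_l X k l * y l) <= L + e.
Proof.
move=> L0 w0 X0 wtot hall e e0.
pose S k := [set j | 0 < X k j].
pose row (y : J -> R) k := \sum_l X k l * y l.
pose Phi y := \sum_k w k * ln (row y k) - L * \sum_j ln (y j).
have term_le_row y k j : (forall j, 0 < y j) -> X k j * y j <= row y k.
  move=> y0; rewrite /row (bigD1 j)//= lerDl sumr_ge0 // => l _.
  by rewrite mulr_ge0 // ltW.
have row_gt0 y k : (forall j, 0 < y j) -> 0 < w k -> 0 < row y k.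
  move=> y0 wk; have [j jS] : exists j, j \in S k.
    apply/set0Pn/negP => /eqP Sk.
    have := hall finset.set0.
    rewrite cards0 mulr0 (bigD1 k) /=; last by rewrite -/(S k) Sk finset.sub0set.
    by apply/negP; rewrite -ltNge ltr_pwDl ?sumr_ge0.
  rewrite inE in jS.
  by apply: lt_le_trans (term_le_row y k j y0); rewrite mulr_gt0.
(* [C] dominates every [- ln (X k j)], so [ln (row y k) + C] is at least [ln (y j)] on the support
   of row [k], as the Hall inequality requires. *)
pose C := \sum_k \sum_j `|ln (X k j)|.
have Phi_ge y : (forall j, 0 < y j) -> - (C * \sum_k w k) <= Phi y.
  move=> y0.
  have : L * \sum_j ln (y j) <= \sum_k w k * (ln (row y k) + C).
    apply: (hall_weighted_sum_le w0 wtot hall) => k j wk; rewrite inE => Xkj.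
    have lnX : - ln (X k j) <= C.
      rewrite (le_trans (ler_norm _)) // normrN /C (bigD1 k)//= (bigD1 j)//=.
      by rewrite -addrA lerDl addr_ge0 // sumr_ge0 // => k' _; apply: sumr_ge0.
    have : ln (X k j * y j) <= ln (row y k).
      by rewrite ler_ln ?posrE ?row_gt0 ?mulr_gt0 // term_le_row.
    rewrite lnM ?posrE //; lra.
  under [X in _ <= X -> _]eq_bigr do rewrite mulrDr.
  by rewrite big_split /= -mulr_suml /Phi; lra.
pose E : set R := [set Phi y | y in [set y | forall j, 0 < y j]]%classic.
have infE : has_inf E.
  split; first by exists (Phi (fun=> 1)), (fun=> 1) => //= j.
  by exists (- (C * \sum_k w k)) => _ [y /= y0 <-]; apply: Phi_ge.
have t_den : 0 < 4 * (L + 1) + 2 * e by lra.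
(* The step size is chosen to give [t <= 1 / 2] and [L * t <= e / 4], so that the second-order error
   [2 * L * t] is at most [e / 2]. *)
pose t := e / (4 * (L + 1) + 2 * e).
have t0 : 0 < t by rewrite divr_gt0.
have tE : t * (4 * (L + 1) + 2 * e) = e by rewrite mulfVK // gt_eqF.
have t12 : t <= 1 / 2 by rewrite ler_pdivrMr //; lra.
have tL : L * t <= e / 4 by have := mulr_gt0 t0 e0; nra.
have te0 : 0 < t * (e / 2) by rewrite mulr_gt0 // divr_gt0.
have [_ [y /= y0 <-] Phi_y] := inf_adherent te0 infE.
exists y => // j; rewrite -/(row y _).
set f := \sum_k _.
(* Shrinking one coordinate by [1 - t] lowers the row terms by at least [t * f] and costs
   [- L * ln (1 - t)]. Since [Phi] cannot drop below its infimum, this bounds [f]. *)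
pose y' i := if i == j then (1 - t) * y i else y i.
have y'0 i : 0 < y' i.
  by rewrite /y'; case: eqP => // _; rewrite mulr_gt0 //; lra.
have rowE k : row y' k = row y k - t * (X k j * y j).
  rewrite /row (bigD1 j)//= [in RHS](bigD1 j)//= /y' eqxx.
  rewrite (eq_bigr (fun i => X k i * y i)) => [|i /negPf->] //; ring.
have lnE : \sum_i ln (y' i) = \sum_i ln (y i) + ln (1 - t).
  rewrite (bigD1 j)//= [in RHS](bigD1 j)//= /y' eqxx lnM ?posrE //; last lra.
  rewrite (eq_bigr (fun i => ln (y i))) => [|i /negPf->] //; ring.
have infy' : inf E <= Phi y' by apply: ge_inf; [case: infE|exists y'].
have lnrow : \sum_k w k * ln (row y' k) <= \sum_k w k * ln (row y k) - t * f.
  rewrite /f mulr_sumr -sumrB ler_sum // => k _.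
  have := w0 k; rewrite le_eqVlt => /predU1P[<-|wk].
    by rewrite !mul0r mulr0 subr0.
  have r0 := row_gt0 y k y0 wk; have r'0 := row_gt0 y' k y'0 wk.
  rewrite mulrCA -mulrBr ler_pM2l //.
  have r'E : row y' k = row y k * (1 + - (t * (X k j * y j / row y k))).
    by rewrite rowE; field; rewrite gt_eqF.
  have p1 : -1 < - (t * (X k j * y j / row y k)).
    have : 0 < 1 + - (t * (X k j * y j / row y k)).
      by rewrite -(pmulr_rgt0 _ r0) -r'E.
    lra.
  rewrite r'E lnM ?posrE //; last lra.
  by rewrite lerD2l le_ln1Dx.
have lnt : - ln (1 - t) <= t + 2 * t * t.
  rewrite -lnV ?posrE; last lra.
  have -> : (1 - t)^-1 = 1 + t / (1 - t) by field; apply/eqP; lra.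
  rewrite (le_trans (le_ln1Dx _)) //.
    by apply: (@lt_le_trans _ _ 0); [lra | apply: divr_ge0; lra].
  by rewrite ler_pdivrMr; [nra | lra].
have key : t * f <= t * (e / 2) + L * (t + 2 * t * t).
  have := ler_wpM2l L0 lnt.
  by move: infy' Phi_y lnrow; rewrite /Phi lnE; lra.
by rewrite -(ler_pM2l t0); nra.
Qed.

(** * Trace, Frobenius norm and rank *)

Lemma frobenius_norm_trace (C : numClosedFieldType) m n (G : 'M[C]_(m, n)) :
  \tr (map_mx Num.conj G^T *m G) = \sum_i \sum_j `|G i j| ^+ 2.
Proof.
rewrite /mxtrace exchange_big /=; apply: eq_bigr => j _; rewrite mxE.
by apply: eq_bigr => i _; rewrite !mxE mulrC normCK.
Qed.

(* Expand [0 <= |H - c Q|^2] for the Frobenius norm, where [Q] is the orthogonal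
   projection onto the complement of the row space of [N]. *)
Lemma trace_le_frobenius (C : numClosedFieldType) d n (N : 'M[C]_(d, n))
    (H : 'M[C]_n) (c : C) :
  row_free N -> N *m H = 0 -> c \is Num.real -> \tr H \is Num.real ->
  2 * c * \tr H <=
    \sum_i \sum_j `|H i j| ^+ 2 + c ^+ 2 * (n%:R - d%:R).
Proof.
move=> Nfree NH cR trR.
pose adj m p (A : 'M[C]_(m, p)) := map_mx Num.conj A^T.
have adjM m p q (A : 'M[C]_(m, p)) (B : 'M[C]_(p, q)) :
    adj _ _ (A *m B) = adj _ _ B *m adj _ _ A.
  by rewrite /adj trmx_mul map_mxM.
have adjK m p (A : 'M[C]_(m, p)) : adj _ _ (adj _ _ A) = A.
  by apply/matrixP => i j; rewrite !mxE conjCK.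
have adjB m p (A B : 'M[C]_(m, p)) : adj _ _ (A - B) = adj _ _ A - adj _ _ B.
  by apply/matrixP => i j; rewrite !mxE rmorphB.
have dn : (d <= n)%N by rewrite -(eqP Nfree) rank_leq_col.
pose B := schmidt N.
have BB : B *m adj _ _ B = 1%:M by apply/unitarymxP/schmidt_unitarymx.
have BH : B *m H = 0.
  have /submxP[D ->] : (B <= N)%MS by rewrite eqmx_schmidt_free.
  by rewrite -mulmxA NH mulmx0.
pose Q : 'M[C]_n := 1%:M - adj _ _ B *m B.
have adjQ : adj _ _ Q = Q.
  rewrite /Q adjB adjM adjK; congr (_ - _).
  by apply/matrixP => i j; rewrite !mxE eq_sym rmorph_nat.
have QH : Q *m H = H by rewrite mulmxBl mul1mx -mulmxA BH mulmx0 subr0.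
have QQ : Q *m Q = Q.
  rewrite {2}/Q mulmxBr mulmx1 mulmxA {2}/Q mulmxBl mul1mx.
  by rewrite -[_ *m B *m _]mulmxA BB mulmx1 subrr mul0mx subr0.
have HQ : adj _ _ H *m Q = adj _ _ H by rewrite -{1}adjQ -adjM QH.
have trQ : \tr Q = n%:R - d%:R by rewrite raddfB /= mxtrace_mulC BB !mxtrace1.
clearbody Q.
have trH : \tr (adj _ _ H) = \tr H.
  rewrite -[RHS](CrealP trR) /mxtrace rmorph_sum.
  by apply: eq_bigr => i _; rewrite !mxE.
have := frobenius_norm_trace (H - c *: Q).
have -> : map_mx Num.conj (H - c *: Q)^T = adj _ _ H - c *: Q.
  rewrite -/(adj _ _ _) adjB; congr (_ - _); rewrite -[in RHS]adjQ.
  by apply/matrixP => i j; rewrite !mxE rmorphM /= (CrealP cR).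
rewrite mulmxBl !mulmxBr -!scalemxAl -!scalemxAr QH HQ QQ.
rewrite !raddfB /= !mxtraceZ trH trQ frobenius_norm_trace => trE.
have : 0 <= \sum_i \sum_j `|(H - c *: Q) i j| ^+ 2.
  by apply: sumr_ge0 => i _; apply: sumr_ge0 => j _; rewrite exprn_ge0.
rewrite -trE => G0; rewrite -subr_ge0; apply: le_trans G0 _.
by rewrite le_eqVlt; apply/predU1l; ring.
Qed.

(** The sum of [c k * (S * z k - A) ^+ 2] is [S] times the gap between the two sides; if [S]
    vanishes, so do all the weights in [P]. *)
Lemma weighted_cauchy_schwarz (R : realFieldType) (K : finType) (P : pred K)
    (c z : K -> R) :
  (forall k, 0 <= c k) ->
  (\sum_(k | P k) c k * z k) ^+ 2 <=
    (\sum_(k | P k) c k) * \sum_(k | P k) c k * z k ^+ 2.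
Proof.
move=> c0; set S := \sum_(k | P k) c k; set A := \sum_(k | P k) _.
set B := \sum_(k | P k) _.
have S0 : 0 <= S by apply: sumr_ge0.
have : 0 <= \sum_(k | P k) c k * (S * z k - A) ^+ 2.
  by apply: sumr_ge0 => k _; rewrite mulr_ge0 // sqr_ge0.
have -> : \sum_(k | P k) c k * (S * z k - A) ^+ 2 = S * (S * B - A ^+ 2).
  transitivity (\sum_(k | P k) (S ^+ 2 * (c k * z k ^+ 2)
      - 2 * S * A * (c k * z k) + A ^+ 2 * c k)).
    by apply: eq_bigr => k _; ring.
  by rewrite big_split sumrB /= -!mulr_sumr -/S -/A -/B; ring.
move: S0; rewrite le_eqVlt => /predU1P[S0 _|S0].
  have cP k : P k -> c k = 0.
    by move=> Pk; apply: (psumr_eq0P _ (esym S0) Pk) => i _; apply: c0.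
  by rewrite /A big1 ?expr0n -?S0 ?mul0r // => k /cP->; rewrite mul0r.
by rewrite pmulr_rge0 // subr_ge0.
Qed.

(** The weighted Gram matrix [H] of the scaled rows has trace [L * n], diagonal at most [L + e] and
    a small off-diagonal part, while [d] independent vectors kill it. Comparing trace and Frobenius
    norm bounds [d]. *)
Lemma design_matrix_bound (R : realType) d n (K : finType) (w : K -> R)
    (a : K -> 'I_n -> R[i]) (N : 'M[R[i]]_(d, n)) (L D : R) :
  0 <= L -> 0 <= D -> (forall k, 0 <= w k) -> row_free N ->
  (forall k, 0 < w k -> forall i, \sum_j N i j * a k j = 0) ->
  (forall k, 0 < w k -> (#|[set j | a k j != 0%R]| <= 3)%N) ->
  (forall i j, i != j ->
    \sum_(k | (a k i != 0) && (a k j != 0)) w k <= D) ->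
  \sum_k w k = L * n%:R ->
  (forall A : {set 'I_n},
    \sum_(k | [set j | a k j != 0] \subset A) w k <= L * #|A|%:R) ->
  L * d%:R <= 2 / 3 * D * n%:R.
Proof.
move=> L0 D0 w0 Nfree Na supp3 pairD wtot hall.
move: (L0); rewrite le_eqVlt => /predU1P[<-|Lgt0].
  by rewrite mul0r mulr_ge0 // mulr_ge0 //; lra.
suff approx e : 0 < e ->
    L ^+ 2 * d%:R <= 2 / 3 * D * L * n%:R + n%:R * (2 * L * e + e ^+ 2).
  rewrite -(ler_pM2l Lgt0) leNgt; apply/negP => gap.
  set g := L * (L * d%:R) - L * (2 / 3 * D * n%:R).
  have g0 : 0 < g by rewrite subr_gt0.
  have n0 : 0 <= n%:R :> R by [].
  (* For [e <= 1] the error is at most [n * (2 * L + 1) * e], which is less than [e * T = g],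
     contradicting the gap [g]. *)
  pose T := n%:R * (2 * L + 1) + 1 + g.
  have T0 : 0 < T by rewrite /T; nra.
  pose e := g / T.
  have e0 : 0 < e by rewrite divr_gt0.
  have eT : e * T = g by rewrite mulfVK // gt_eqF.
  have e1 : e <= 1 by rewrite ler_pdivrMr // mul1r /T; nra.
  have := approx e e0; rewrite /T /g in eT g0 *.
  have : n%:R * e ^+ 2 <= n%:R * e by rewrite ler_wpM2l // expr2; nra.
  nra.
move=> e0.
(* The scaling acts on squared moduli: column [i] of [a] is multiplied by [s i], the square root of
   [y i], and row [k] is divided by the square root of [r k]. The squared moduli after scaling are
   the [q k i]. *)
pose X k j : R := Normc.normc (a k j) ^+ 2.
have X0 k j : 0 <= X k j by rewrite sqr_ge0.
have Xgt0 k j : (0 < X k j) = (a k j != 0).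
  rewrite lt0r X0 andbT sqrf_eq0; congr (~~ _).
  by apply/eqP/eqP => [/Normc.eq0_normc|->] //; rewrite Normc.normc0.
have suppE k : [set j | 0 < X k j] = [set j | a k j != 0].
  by apply/setP => j; rewrite !inE Xgt0.
have [||y y0 fle] := @approximate_scaling R _ K w X L L0 w0 X0 _ _ e e0.
- by rewrite card_ord.
- by move=> A; under eq_bigl do rewrite suppE.
pose r k := \sum_l X k l * y l.
have r_ge0 k : 0 <= r k by apply: sumr_ge0 => l _; rewrite mulr_ge0 // ltW.
have r_gt0 k : 0 < w k -> 0 < r k.
  move=> wk; rewrite lt0r r_ge0 andbT; apply/eqP => rk0.
  have Xk0 j : X k j = 0.
    have /eqP : X k j * y j = 0.
      by apply: (psumr_eq0P _ rk0) => // l _; rewrite mulr_ge0 // ltW.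
    by rewrite mulf_eq0 (gt_eqF (y0 j)) orbF => /eqP.
  have := hall finset.set0; rewrite cards0 mulr0 (bigD1 k) /=; last first.
    by apply/fintype.subsetP => j; rewrite inE -Xgt0 Xk0 ltxx.
  by apply/negP; rewrite -ltNge ltr_pwDl ?sumr_ge0.
pose q k i := X k i * y i / r k.
have q0 k i : 0 <= q k i by rewrite divr_ge0 // mulr_ge0 // ltW.
have q1 k : 0 < w k -> \sum_i q k i = 1.
  by move=> wk; rewrite -mulr_suml mulfV // gt_eqF // r_gt0.
pose s i := Num.sqrt (y i).
have s0 i : 0 < s i by rewrite sqrtr_gt0.
have sE i : s i ^+ 2 = y i by rewrite sqr_sqrtr // ltW.
pose b k i : R[i] := a k i * (s i)%:C.
pose H : 'M[R[i]]_n :=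
  \matrix_(i, j) \sum_k (w k / r k)%:C * b k i * Num.conj (b k j).
have HE i : H i i = (\sum_k w k * q k i)%:C.
  rewrite mxE rmorph_sum; apply: eq_bigr => k _.
  rewrite -mulrA -normCK /b normrM exprMn.
  have -> : `|a k i| ^+ 2 = (X k i)%:C by rewrite /X rmorphXn.
  have -> : `|(s i)%:C| ^+ 2 = (y i)%:C.
    by rewrite -sE rmorphXn /= ger0_norm // ler0c ltW.
  by rewrite -!rmorphM /q; congr (_%:C); ring.
have trH : \tr H = (L * n%:R)%:C.
  rewrite /mxtrace; under eq_bigr do rewrite HE.
  rewrite -rmorph_sum exchange_big /= -wtot; congr (_%:C).
  apply: eq_bigr => k _; rewrite -mulr_sumr.
  have := w0 k; rewrite le_eqVlt => /predU1P[<-|wk]; first by rewrite mul0r.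
  by rewrite q1 // mulr1.
(* Undoing the column scaling in [N] makes it kill the scaled rows, hence [H]. *)
pose N' : 'M[R[i]]_(d, n) := N *m diag_mx (\row_j ((s j)^-1)%:C).
have N'free : row_free N'.
  rewrite /row_free mxrankMfree // row_free_unit unitmxE det_diag unitfE.
  apply/prodf_neq0 => j _; rewrite mxE fmorph_eq0 invr_eq0 gt_eqF //.
have N'H : N' *m H = 0.
  apply/matrixP => l j; rewrite mxE [RHS]mxE.
  under eq_bigr => i _ do rewrite /N' mul_mx_diag !mxE mulr_sumr.
  rewrite exchange_big big1 //= => k _.
  have := w0 k; rewrite le_eqVlt => /predU1P[<-|wk].
    by rewrite big1 // => i _; rewrite !mul0r mulr0.
  transitivity ((w k / r k)%:C * Num.conj (b k j) * \sum_i N l i * a k i).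
    rewrite mulr_sumr; apply: eq_bigr => i _; rewrite /b.
    have s1 : ((s i)^-1)%:C * (s i)%:C = 1 :> R[i].
      by rewrite -rmorphM mulVf ?gt_eqF.
    by rewrite -[RHS]mulr1 -s1; ring.
  by rewrite Na // mulr0.
pose F : R := \sum_i \sum_j Normc.normc (H i j) ^+ 2.
have FE : \sum_i \sum_j `|H i j| ^+ 2 = F%:C.
  rewrite rmorph_sum; apply: eq_bigr => i _.
  by rewrite rmorph_sum; apply: eq_bigr => j _; rewrite rmorphXn.
(* Cauchy-Schwarz over the rows that are nonzero at both [i] and [j], whose total weight is at most
   [D]. *)
have offdiag i j : i != j ->
    Normc.normc (H i j) ^+ 2 <= D * \sum_k w k * (q k i * q k j).
  move=> ij.
  pose u k l := Normc.normc (a k l) * s l / Num.sqrt (r k).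
  have uE k l : u k l ^+ 2 = q k l.
    by rewrite /u expr_div_n exprMn sE sqr_sqrtr.
  have normc_ge0 (z : R[i]) : 0 <= Normc.normc z.
    by rewrite -ler0c; apply: (normr_ge0 z).
  have u0 k l : 0 <= u k l by rewrite divr_ge0 ?sqrtr_ge0 // mulr_ge0 // ltW.
  have Hu : Normc.normc (H i j) <= \sum_k w k * (u k i * u k j).
    rewrite -lecR; change ((Normc.normc (H i j))%:C) with `|H i j|.
    rewrite mxE (le_trans (ler_norm_sum _ _ _)) // rmorph_sum ler_sum // => k _.
    rewrite !normrM norm_conjC /b !normrM.
    have normR (x : R) : 0 <= x -> `|x%:C| = x%:C.
      by move=> x0; rewrite ger0_norm // ler0c.
    rewrite !normR ?divr_ge0 ?(ltW (s0 _)) //.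
    have normE (z : R[i]) : `|z| = (Normc.normc z)%:C by [].
    rewrite !normE -!rmorphM lecR le_eqVlt; apply/predU1l.
    have := w0 k; rewrite le_eqVlt => /predU1P[<-|wk]; first by rewrite !mul0r.
    have rE : r k = Num.sqrt (r k) ^+ 2 by rewrite sqr_sqrtr.
    have sr0 : Num.sqrt (r k) != 0 by rewrite gt_eqF // sqrtr_gt0 r_gt0.
    by rewrite {1}rE /u; field.
  have Hu2 : Normc.normc (H i j) ^+ 2 <= (\sum_k w k * (u k i * u k j)) ^+ 2.
    by apply: lerXn2r; rewrite ?nnegrE // (le_trans _ Hu).
  apply: le_trans Hu2 _.
  rewrite (bigID (fun k => (a k i != 0) && (a k j != 0))) /= [X in _ + X]big1.
    rewrite addr0 (le_trans (weighted_cauchy_schwarz _ _ w0)) //.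
    apply: ler_pM.
    - exact: sumr_ge0.
    - by apply: sumr_ge0 => k _; rewrite mulr_ge0 // sqr_ge0.
    - exact: pairD.
    rewrite [leRHS](bigID (fun k => (a k i != 0) && (a k j != 0))) /=.
    rewrite -[leLHS]addr0; apply: lerD.
      by apply: ler_sum => k _; rewrite exprMn !uE.
    by apply: sumr_ge0 => k _; rewrite mulr_ge0 // mulr_ge0.
  move=> k; rewrite negb_and !negbK /u => /orP[]/eqP->;
    by rewrite Normc.normc0 !(mul0r, mulr0).
have diag i : Normc.normc (H i i) ^+ 2 <= (L + e) ^+ 2.
  have f0 : 0 <= \sum_k w k * q k i by apply: sumr_ge0 => k _; rewrite mulr_ge0.
  have -> : Normc.normc (H i i) = \sum_k w k * q k i.
    by apply: complexI; rewrite -[LHS]/(`|H i i|) HE ger0_norm // ler0c.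
  by rewrite lerXn2r ?nnegrE ?fle // addr_ge0 // ltW.
(* At most three of the [q k i] are nonzero and they sum to 1, so their squares sum to at least 1/3.
   This is the source of the constant 2/3. *)
have q_pairs k : 0 < w k -> \sum_i \sum_(j | j != i) q k i * q k j <= 2 / 3.
  move=> wk.
  have third : 1 <= 3 * \sum_i q k i ^+ 2.
    pose S := [set j | a k j != 0].
    have qS i : i \notin S -> q k i = 0.
      by rewrite inE -Xgt0 lt0r X0 andbT negbK /q => /eqP->; rewrite !mul0r.
    have qsum : \sum_(i in S) 1 * q k i = 1.
      under eq_bigr do rewrite mul1r.
      rewrite -[RHS](q1 k wk) [RHS](bigID (mem S)) /= [X in _ + X]big1 ?addr0 //.
    have := @weighted_cauchy_schwarz R _ (mem S) (fun=> 1) (q k) (fun=> ler01).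
    rewrite qsum expr1n sumr_const => /le_trans; apply; apply: ler_pM => //.
    - by apply: sumr_ge0 => i _; rewrite mul1r sqr_ge0.
    - by rewrite (ler_nat R _ 3) supp3.
    - rewrite [leRHS](bigID (mem S)) /= -[leLHS]addr0 lerD //.
        by apply: ler_sum => i _; rewrite mul1r.
      by apply: sumr_ge0 => i _; rewrite sqr_ge0.
  have -> : \sum_i \sum_(j | j != i) q k i * q k j = 1 - \sum_i q k i ^+ 2.
    apply/eqP; rewrite eq_sym subr_eq -big_split /=; apply/eqP.
    rewrite -[LHS](q1 k wk); apply: eq_bigr => i _.
    rewrite -mulr_sumr expr2 -mulrDr addrC -(bigD1 i (P := predT) (F := q k)) //=.
    by rewrite q1 // mulr1.
  lra.
have Fle : F <= n%:R * (L + e) ^+ 2 + D * (2 / 3 * (L * n%:R)).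
  have -> : F = \sum_i Normc.normc (H i i) ^+ 2
      + \sum_i \sum_(j | j != i) Normc.normc (H i j) ^+ 2.
    by rewrite -big_split; apply: eq_bigr => i _; rewrite (bigD1 i).
  apply: lerD.
    apply: (@le_trans _ _ (\sum_(i < n) (L + e) ^+ 2)); first exact: ler_sum.
    by rewrite sumr_const card_ord mulr_natl.
  apply: (@le_trans _ _ (\sum_i \sum_(j | j != i)
                           D * \sum_k w k * (q k i * q k j))).
    by apply: ler_sum => i _; apply: ler_sum => j ij; rewrite offdiag // eq_sym.
  under eq_bigr do rewrite -mulr_sumr.
  rewrite -mulr_sumr ler_wpM2l //.
  under eq_bigr do rewrite exchange_big.
  rewrite exchange_big -wtot mulr_sumr ler_sum // => k _ /=.
  have -> : \sum_i \sum_(j | j != i) w k * (q k i * q k j)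
      = w k * \sum_i \sum_(j | j != i) q k i * q k j.
    by rewrite mulr_sumr; apply: eq_bigr => i _; rewrite mulr_sumr.
  have := w0 k; rewrite le_eqVlt => /predU1P[<-|wk]; first by rewrite mul0r mulr0.
  by rewrite mulrC ler_pM2r // q_pairs.
have realC (x : R) : x%:C \is Num.real by apply/complex_realP; exists x.
(* The choice of [L] as [c] is the average diagonal entry of [H]; the terms [n * L ^+ 2] then
   cancel. *)
have := @trace_le_frobenius _ d n N' H L%:C N'free N'H (realC _).
rewrite trH FE => /(_ (realC _)).
rewrite -!(rmorph_nat (real_complex R)) -rmorphB -rmorphXn.
rewrite -!rmorphM -rmorphD lecR.
nra.
Qed.

(** * Collinear triples and their weights *)

Lemma sum_delta (A : pzRingType) (I : finType) (F : I -> A) i :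
  \sum_x F x * (x == i)%:R = F i.
Proof.
rewrite (bigD1 i)//= eqxx mulr1 big1 ?addr0 // => x /negPf->.
by rewrite mulr0.
Qed.

Section CollinearTriples.
Variables (R : realType) (I : finType) (line : I -> I -> {set I}).
Hypothesis line_ends : forall a b, a != b -> (a \in line a b) && (b \in line a b).
Hypothesis line_eq : forall a b c d, a != b -> c \in line a b ->
  d \in line a b -> c != d -> line c d = line a b.

Definition collinear_triple a b c :=
  [&& a != b, a != c, b != c & c \in line a b].

(** The truncated subtraction is harmless: a collinear triple puts three distinct points on its
    line. *)
Definition triple_weight a b c : R :=
  if collinear_triple a b c then (#|line a b| - 2)%:R^-1 else 0.

Definition triple_set (t : I * I * I) : {set I} := [set t.1.1; t.1.2; t.2].

Definition weight_in (U : {set I}) : R :=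
  \sum_(t : I * I * I | triple_set t \subset U) triple_weight t.1.1 t.1.2 t.2.

Lemma triple_weight_ge0 a b c : 0 <= triple_weight a b c.
Proof. by rewrite /triple_weight; case: ifP => // _; rewrite invr_ge0. Qed.

Lemma collinear_tripleP a b c : collinear_triple a b c ->
  [/\ a != b, a != c, b != c & {in [set a; b; c] &, forall x y, x != y ->
    line x y = line a b}].
Proof.
move=> /and4P[ab ac bc cab]; split=> // x y; have /andP[aab bab] := line_ends ab.
have sub z : z \in [set a; b; c] -> z \in line a b.
  by rewrite !inE -orbA => /or3P[]/eqP->.
by move=> /sub xl /sub yl; apply: line_eq.
Qed.

Lemma triple_weight_perm a b c a' b' c' :
    [set a; b; c] = [set a'; b'; c'] -> collinear_triple a b c ->
    a' != b' -> a' != c' -> b' != c' ->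
  triple_weight a' b' c' = triple_weight a b c.
Proof.
move=> eqS abc ab' ac' bc'; have [ab ac bc lineE] := collinear_tripleP abc.
have lab : line a' b' = line a b by rewrite lineE // eqS !inE eqxx ?orbT.
have lac : line a' c' = line a b by rewrite lineE // eqS !inE eqxx ?orbT.
have /andP[_ cl] := line_ends ac'.
by rewrite /triple_weight abc /collinear_triple ab' ac' bc' lab -lac cl.
Qed.

Lemma triple_weight_distinct a b c :
  (a == b) || (a == c) || (b == c) -> triple_weight a b c = 0.
Proof.
rewrite /triple_weight; case: ifP => // /and4P[/negPf-> /negPf-> /negPf->].
by [].
Qed.

Lemma triple_weightC a b c : triple_weight b a c = triple_weight a b c.
Proof.
have [|/negPf nabc] := boolP (collinear_triple a b c).
  move=> abc; have /and4P[ab ac bc _] := abc.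
  by apply: triple_weight_perm; rewrite // 1?eq_sym // (finset.setUC [set a]).
have [|/negPf nbac] := boolP (collinear_triple b a c); last first.
  by rewrite /triple_weight nabc nbac.
move=> bac; have /and4P[ab ac bc _] := bac.
by apply/esym/triple_weight_perm; rewrite // 1?eq_sym // (finset.setUC [set b]).
Qed.

Lemma triple_weightAC a b c : triple_weight a c b = triple_weight a b c.
Proof.
have [|/negPf nabc] := boolP (collinear_triple a b c).
  move=> abc; have /and4P[ab ac bc _] := abc.
  by apply: triple_weight_perm; rewrite // 1?eq_sym // finset.setUAC.
have [|/negPf nacb] := boolP (collinear_triple a c b); last first.
  by rewrite /triple_weight nabc nacb.
move=> acb; have /and4P[ab ac bc _] := acb.
by apply/esym/triple_weight_perm; rewrite // 1?eq_sym // finset.setUAC.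
Qed.

(** A line with [r > 2] points offers [r - 2] choices of [c], each of weight [1 / (r - 2)]; an
    ordinary line offers none. *)
Lemma sum_triple_weight a b :
  \sum_c triple_weight a b c = ((a != b) && (2 < #|line a b|)%N)%:R.
Proof.
have [<-|ab] /= := eqVneq a b.
  by rewrite big1 // => c _; rewrite triple_weight_distinct ?eqxx.
have /andP[aab bab] := line_ends ab.
rewrite /triple_weight -big_mkcond /= sumr_const.
have -> : #|[pred c | collinear_triple a b c]| = (#|line a b| - 2)%N.
  have -> : (#|line a b| - 2)%N = #|line a b :\ a :\ b|.
    rewrite [in LHS](cardsD1 a) aab (cardsD1 b).
    by rewrite !inE eq_sym ab bab /= addnA addKn.
  apply: eq_card => c.
  by rewrite !inE /collinear_triple ab /= eq_sym (eq_sym b) andbCA.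
rewrite -[_ *+ _]mulr_natl ltnNge -subn_eq0.
by case: (_ - 2)%N => [|m]; rewrite ?mul0r // mulfV // pnatr_eq0.
Qed.

Lemma sum_triple_weight_le1 a b : \sum_c triple_weight a b c <= 1.
Proof. by rewrite sum_triple_weight lern1 leq_b1. Qed.

(** Grouping the triples by their first two points, each ordered pair in [U] contributes at most
    1. *)
Lemma weight_in_le (U : {set I}) : weight_in U <= #|U|%:R ^+ 2.
Proof.
rewrite /weight_in (@le_trans _ _
  (\sum_(ab : I * I | (ab.1 \in U) && (ab.2 \in U))
   \sum_c triple_weight ab.1 ab.2 c)) //.
  rewrite pair_big_dep /= [leLHS]big_mkcond [leRHS]big_mkcond.
  rewrite ler_sum // => t _ /=.
  case: ifP => tU; last by case: ifP => // _; apply: triple_weight_ge0.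
  rewrite !(fintype.subsetP tU) // !inE eqxx ?orbT //.
rewrite -(pair_big (mem U) (mem U) (fun a b => \sum_c triple_weight a b c)) /=.
apply: (@le_trans _ _ (\sum_(a in U) \sum_(b in U) 1)).
  by do 2![apply: ler_sum => ? _]; apply: sum_triple_weight_le1.
by under eq_bigr do rewrite sumr_const; rewrite sumr_const expr2 mulr_natr.
Qed.

Lemma weight_in_setT :
  weight_in [set: I] =
    \sum_a \sum_b ((a != b) && (2 < #|line a b|)%N)%:R.
Proof.
rewrite /weight_in (eq_bigl xpredT) => [|t]; last by rewrite finset.subsetT.
rewrite -(pair_bigA _ (fun ab c => triple_weight ab.1 ab.2 c)) /=.
rewrite -(pair_bigA _ (fun a b => \sum_c triple_weight a b c)) /=.
by do 2![apply: eq_bigr => ? _]; apply: sum_triple_weight.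
Qed.

Lemma weight_in0 : weight_in finset.set0 = 0.
Proof.
apply: big1 => -[[a b] c] /fintype.subsetP/(_ a).
by rewrite !inE eqxx /= => /(_ isT).
Qed.

(** The points [i] and [j] occupy two of the three positions in 6 ordered ways. For each way, the
    symmetry of the weight lets the free point be summed as the third, giving at most 1. *)
Lemma pair_weight_le6 i j : i != j ->
  \sum_(t | (i \in triple_set t) && (j \in triple_set t))
    triple_weight t.1.1 t.1.2 t.2 <= 6.
Proof.
move=> ij.
pose pos (x y : I) := (x == i)%:R * (y == j)%:R + (x == j)%:R * (y == i)%:R : R.
have sum2 (F : I -> I -> R) :
    \sum_x \sum_y F x y * pos x y = F i j + F j i.
  have sum1 k l : \sum_x \sum_y F x y * ((x == k)%:R * (y == l)%:R) = F k l.
    rewrite -[RHS](sum_delta (F ^~ l)); apply: eq_bigr => x _.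
    rewrite -[in RHS](sum_delta (F x) l) mulr_suml.
    by apply: eq_bigr => y _; ring.
  rewrite -(sum1 i j) -(sum1 j i) -big_split; apply: eq_bigr => x _.
  by rewrite -big_split; apply: eq_bigr => y _; rewrite mulrDr.
apply: (@le_trans _ _ (\sum_a \sum_b \sum_c
    triple_weight a b c * (pos a b + pos a c + pos b c))).
  rewrite (pair_bigA _ (fun a b => \sum_c triple_weight a b c *
    (pos a b + pos a c + pos b c))) (pair_bigA _ (fun ab c =>
    triple_weight ab.1 ab.2 c * (pos ab.1 ab.2 + pos ab.1 c + pos ab.2 c))) /=.
  rewrite big_mkcond ler_sum // => -[[a b] c] _ /=.
  have pos0 x y : 0 <= pos x y by rewrite addr_ge0 // mulr_ge0.
  have w0 := triple_weight_ge0 a b c.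
  case: ifP => [|_]; last by rewrite mulr_ge0 // addr_ge0 // addr_ge0.
  rewrite !inE /= => ijt; rewrite -[leLHS]mulr1 ler_wpM2l //.
  have posE x y : (i == x) && (j == y) || (i == y) && (j == x) -> 1 <= pos x y.
    case/orP=> /andP[/eqP<- /eqP<-]; rewrite /pos !eqxx mulr1.
      by rewrite lerDl mulr_ge0.
    by rewrite lerDr mulr_ge0.
  have : [|| (i == a) && (j == b) || (i == b) && (j == a),
             (i == a) && (j == c) || (i == c) && (j == a) |
             (i == b) && (j == c) || (i == c) && (j == b)].
    case/andP: ijt => /orP[/orP[]|]/eqP ix /orP[/orP[]|]/eqP jx;
    by move: ij; rewrite ix jx !eqxx ?orbT.
  have := pos0 a b; have := pos0 a c; have := pos0 b c.
  by move=> ? ? ? /or3P[]/posE; lra.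
have w1 := sum_triple_weight_le1.
have s1 : \sum_a \sum_b \sum_c triple_weight a b c * pos a b <= 2.
  under eq_bigr do under eq_bigr do rewrite -mulr_suml.
  by rewrite sum2 (le_trans (lerD (w1 _ _) (w1 _ _))).
have s2 : \sum_a \sum_b \sum_c triple_weight a b c * pos a c <= 2.
  apply: le_trans s1; under eq_bigr do rewrite exchange_big.
  by do 3![apply: ler_sum => ? _]; rewrite triple_weightAC.
have s3 : \sum_a \sum_b \sum_c triple_weight a b c * pos b c <= 2.
  apply: le_trans s2; rewrite exchange_big /=.
  by do 3![apply: ler_sum => ? _]; rewrite triple_weightC.
clearbody pos.
under eq_bigr do under eq_bigr do under eq_bigr do rewrite !mulrDr.
under eq_bigr do under eq_bigr do rewrite !big_split.
under eq_bigr do rewrite !big_split.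
rewrite !big_split /=; lra.
Qed.

(* The densest subset satisfies the Hall-type hypothesis of
   [design_matrix_bound], because its own subsets are no denser. *)
Lemma densest_subset_bound d (M : I -> 'I_d -> R[i]) :
  (0 < #|I|)%N ->
  (forall a b c, collinear_triple a b c -> exists v : I -> R[i],
    (forall x, (v x != 0) = (x \in [set a; b; c])) /\
    forall i, \sum_x M x i * v x = 0) ->
  exists U : {set I}, [/\ (0 < #|U|)%N,
    weight_in [set: I] * #|U|%:R <= weight_in U * #|I|%:R &
    row_free (\matrix_(i < d, j < #|U|) M (enum_val j) i) ->
      weight_in U * d%:R <= 4 * #|U|%:R ^+ 2].
Proof.
move=> I0 coefs.
pose F (U : {set I}) := weight_in U / #|U|%:R.
have T0 : (0 < #|[set: I]|)%N by rewrite cardsT.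
have := @arg_maxP _ _ _ [set: I] (fun U : {set I} => (0 < #|U|)%N) F T0.
case=> U U0 Umax.
have {}Umax (A : {set I}) : (0 < #|A|)%N -> F A <= F U := Umax A.
have U0R : 0 < #|U|%:R :> R by rewrite ltr0n.
exists U; split=> //.
  have := Umax _ T0; rewrite /F ler_pdivrMr ?ltr0n // cardsT.
  by rewrite mulrAC ler_pdivlMr.
(* Triples that are not collinear have weight 0; they get the indicator of their set, so that the
   support is [triple_set t] for every [t]. *)
have /choice[v vP] (t : I * I * I) : exists u : I -> R[i],
    (forall x, (u x != 0) = (x \in triple_set t)) /\
    (collinear_triple t.1.1 t.1.2 t.2 -> forall i, \sum_x M x i * u x = 0).
  case: t => -[a b] c.
  have [/coefs[u [usupp uM]]|nabc] := boolP (collinear_triple a b c).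
    by exists u.
  exists (fun x => (x \in triple_set (a, b, c))%:R); split=> [x|].
    by rewrite pnatr_eq0 eqb0 negbK.
  by move=> abc; case/negP: nabc.
move=> Nfree.
pose w t := if triple_set t \subset U then triple_weight t.1.1 t.1.2 t.2 else 0.
have w_gt0 t : 0 < w t ->
    (triple_set t \subset U) /\ collinear_triple t.1.1 t.1.2 t.2.
  rewrite /w; case: ifP => [tU|]; last by rewrite ltxx.
  by rewrite /triple_weight; case: ifP => // _; rewrite ltxx.
have w0 t : 0 <= w t by rewrite /w; case: ifP => // _; apply: triple_weight_ge0.
have wU : \sum_t w t = weight_in U by rewrite /w -big_mkcond.
have F0 : 0 <= F U by rewrite divr_ge0 // -wU sumr_ge0.
have suppE t : [set j : 'I_#|U| | v t (enum_val j) != 0] =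
    [set j : 'I_#|U| | enum_val j \in triple_set t].
  by apply/setP => j; rewrite !inE (vP t).1 /triple_set !inE.
suff : F U * d%:R <= 4 * #|U|%:R.
  by rewrite /F mulrAC ler_pdivrMr // -mulrA -expr2.
(* The factor 2/3 comes from rows with at most three nonzero entries, the 6 from the total weight of
   the triples through two points. *)
have -> : 4 = 2 / 3 * 6 :> R by field.
apply: (@design_matrix_bound R d #|U| _ w (fun t j => v t (enum_val j))
  _ (F U) 6 F0 (ler0n _ _) w0 Nfree).
- move=> t /w_gt0[tU tcol] i.
  under eq_bigr do rewrite mxE.
  rewrite -(big_enum_val (fun x => M x i * v t x)) /= -[RHS]((vP t).2 tcol i).
  rewrite [RHS](bigID (mem U)) /= [X in _ = _ + X]big1 ?addr0 // => x xU.
  suff /eqP-> : v t x == 0 by rewrite mulr0.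
  by rewrite -[_ == _]negbK (vP t).1; apply: contra xU => /(fintype.subsetP tU).
- move=> t /w_gt0[tU _]; rewrite suppE.
  rewrite -(card_imset _ enum_val_inj) (@leq_trans #|triple_set t|) //.
    apply/subset_leq_card/fintype.subsetP => _ /imsetP[j jt ->].
    by rewrite inE in jt.
  rewrite (leq_trans (leq_card_setU _ _)) // cards1 cards2.
  by case: (_ != _).
- move=> i j ij.
  apply: le_trans (pair_weight_le6 (_ : enum_val i != enum_val j)); last first.
    by rewrite (inj_eq enum_val_inj).
  under eq_bigl do rewrite !(vP _).1.
  apply: ler_sum => t _; rewrite /w; case: ifP => // _.
  exact: triple_weight_ge0.
- by rewrite wU /F mulfVK // gt_eqF.
- move=> A; pose A' : {set I} := enum_val @: A.
  have cA : #|A'| = #|A| by apply: card_imset; apply: enum_val_inj.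
  apply: (@le_trans _ _ (weight_in A')).
    rewrite /weight_in big_mkcond [leRHS]big_mkcond ler_sum // => t _.
    rewrite suppE /w; case: ifP => [|_]; last first.
      by case: ifP => // _; apply: triple_weight_ge0.
    case: (boolP (triple_set t \subset U)) => [|_ _].
      move=> /fintype.subsetP tU /fintype.subsetP tA.
      rewrite ifT //; apply/fintype.subsetP => x xt.
      apply/imsetP; exists (enum_rank_in (tU _ xt) x); last first.
        by rewrite enum_rankK_in ?tU.
      by apply: tA; rewrite inE enum_rankK_in ?tU.
    by case: ifP => // _; apply: triple_weight_ge0.
  (* Maximality compares nonempty subsets only; the empty set carries no weight. *)
  have [A0|A0] := posnP #|A'|.
    by rewrite (cards0_eq A0) weight_in0 mulr_ge0.
  by have := Umax A' A0; rewrite /F ler_pdivrMr ?ltr0n // cA.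
Qed.

End CollinearTriples.

(** * Lines through points of a finite set and ordinary pairs *)

Section PointLines.
Variables (K : fieldType) (E : vectType K).

Lemma affine_line_eq (p q c d : E) :
  c - p \in <[q - p]>%VS -> d - p \in <[q - p]>%VS -> c != d ->
  forall x, (x - c \in <[d - c]>%VS) = (x - p \in <[q - p]>%VS).
Proof.
move=> /vlineP[s cE] /vlineP[t dE] cd x.
have dcE : d - c = (t - s) *: (q - p).
  by rewrite scalerBl -cE -dE opprB addrA subrK.
have ts : t - s != 0.
  by apply: contra_neq cd => ts; apply/esym/eqP; rewrite -subr_eq0 dcE ts scale0r.
apply/vlineP/vlineP => -[l xE].
  exists (l * (t - s) + s).
  by rewrite scalerDl -scalerA -dcE -xE -cE addrA subrK.
exists ((l - s) / (t - s)).
by rewrite dcE scalerA mulfVK // scalerBl -xE -cE opprB addrA subrK.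
Qed.

Variable V : {fset E}.

Definition line_through (a b : V) : {set V} :=
  [set c : V | val c - val a \in <[val b - val a]>%VS].

Lemma line_through_ends a b :
  a != b -> (a \in line_through a b) && (b \in line_through a b).
Proof. by rewrite !inE subrr mem0v memv_line. Qed.

Lemma line_through_eq a b c d : a != b -> c \in line_through a b ->
  d \in line_through a b -> c != d -> line_through c d = line_through a b.
Proof.
rewrite !inE => ab cab dab cd; apply/setP => x; rewrite !inE.
by apply: affine_line_eq.
Qed.

Definition ordinary_pairs : {set V * V} :=
  [set ab | (ab.1 != ab.2) && (#|line_through ab.1 ab.2| == 2%N)].

Definition affine_line (p q : E) : set E :=
  [set x : E | x - p \in <[q - p]>%VS]%classic.

Lemma mem_points_in (A : set E) x :
  (x \in points_in V A) <-> x \in V /\ A x.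
Proof.
rewrite /points_in in_fset /=; split=> [/andP[xV /set_mem]|[xV Ax]] //.
by apply/andP; split=> //; apply: mem_set.
Qed.

Lemma points_in_card_ge (A : set E) (U : {set V}) :
  (forall x, x \in U -> A (val x)) -> (#|U| <= #|` points_in V A|)%N.
Proof.
move=> UA; rewrite cardE -(size_map val); apply: uniq_leq_size.
  by rewrite map_inj_uniq ?enum_uniq //; apply: val_inj.
move=> y /mapP[x]; rewrite mem_enum => xU ->.
by apply/mem_points_in; split; [apply: valP | apply: UA].
Qed.

Lemma points_in_card_le (A : set E) (U : {set V}) :
  (forall x, A (val x) -> x \in U) -> (#|` points_in V A| <= #|U|)%N.
Proof.
move=> AU; rewrite [leqRHS]cardE -(size_map val); apply: uniq_leq_size.
  exact: fset_uniq.
move=> x /mem_points_in[xV Ax]; apply/mapP; exists [` xV]%fset => //.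
by rewrite mem_enum; apply: AU.
Qed.

(** An ordinary line is the [affine_line] through its two points of [V], so there are no more of
    them than pairs. Without finiteness, [fset_set] in [t2] would return its empty default. *)
Lemma finite_ordinary_lines : finite_set (ordinary_lines V).
Proof.
apply: (@sub_finite_set _ _
  ((fun ab : V * V => affine_line (val ab.1) (val ab.2)) @` setT)%classic).
  move=> L [[p [W [dimW LE]]] cardL].
  have /fset0Pn[u uL] : points_in V L != fset0%fset by rewrite -cardfs_gt0 cardL.
  have /fset0Pn[v] : (points_in V L `\ u)%fset != fset0%fset.
    by move: cardL; rewrite -cardfs_gt0 (cardfsD1 u) uL add1n => -[->].
  rewrite in_fsetD1 => /andP[vu] /mem_points_in[vV vL].
  move: uL => /mem_points_in[uV]; rewrite LE in vL * => /= uL.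
  exists ([` uV]%fset, [` vV]%fset) => //=; rewrite /affine_line.
  have <- : W = <[v - u]>%VS.
    have vuW : v - u \in W.
      by have := rpredB vL uL; rewrite opprB addrA subrK.
    apply/esym/eqP; rewrite eqEdim dim_vline dimW subr_eq0 vu andbT.
    by rewrite -memvE.
  have shift x : (x - u \in W) = (x - p \in W).
    by rewrite -(rpredDr (x - u) uL) addrA subrK.
  by apply/seteqP; split=> x /=; rewrite shift.
by apply: finite_image; apply: finite_finset.
Qed.

Lemma affine_line_ordinary a b :
  (a, b) \in ordinary_pairs -> ordinary_lines V (affine_line (val a) (val b)).
Proof.
rewrite inE /= => /andP[ab /eqP card2]; split.
  exists (val a), <[val b - val a]>%VS; split=> //.
  by rewrite dim_vline subr_eq0 (inj_eq val_inj) eq_sym ab.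
apply/eqP; rewrite eqn_leq -[X in (_ <= X)%N && _]card2.
rewrite -[X in _ && (X <= _)%N]card2.
rewrite points_in_card_le ?points_in_card_ge // => x; first by rewrite inE.
by rewrite /affine_line /= inE.
Qed.

(** Of the two orders of a pair, the one increasing in [enum_rank] is kept. Distinct kept pairs give
    distinct lines, as an ordinary line has no third point in [V]. *)
Lemma card_ordinary_pairs_le : (#|ordinary_pairs| <= 2 * t2 V)%N.
Proof.
pose less := [set ab : V * V | (enum_rank ab.1 < enum_rank ab.2)%N].
pose swap (ab : V * V) := (ab.2, ab.1).
have swap_inj : injective swap by move=> [a b] [c d] [-> ->].
have swap_ord ab : (swap ab \in ordinary_pairs) = (ab \in ordinary_pairs).
  case: ab => a b; rewrite !inE /= eq_sym; case: eqVneq => //= ab.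
  have /andP[aab bab] := line_through_ends ab.
  by rewrite (line_through_eq ab bab aab) // eq_sym.
have half : (#|ordinary_pairs| <= 2 * #|ordinary_pairs :&: less|)%N.
  rewrite -(cardsID less) mul2n -addnn leq_add2l -(card_imset _ swap_inj).
  apply/subset_leq_card/fintype.subsetP => _ /imsetP[[a b] + ->].
  rewrite finset.in_setD => /andP[ab_less ab_ord].
  rewrite finset.in_setI swap_ord ab_ord /=.
  move: ab_less ab_ord; rewrite !inE /= -leqNgt leq_eqVlt => /orP[/eqP ba|-> //].
  by have /enum_rank_inj -> := val_inj ba; rewrite eqxx.
apply: leq_trans half _; rewrite leq_mul2l /=.
pose f (ab : V * V) := affine_line (val ab.1) (val ab.2).
rewrite cardE -(size_map f) /t2; apply: uniq_leq_size; last first.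
  move=> y /mapP[[a b]]; rewrite mem_enum finset.in_setI => /andP[ab _] ->.
  rewrite in_fset_set; last exact: finite_ordinary_lines.
  by apply/mem_set/affine_line_ordinary.
rewrite map_inj_in_uniq ?enum_uniq // => -[a b] [c d].
rewrite !mem_enum !finset.in_setI.
move=> /andP[ab_ord ab_less] /andP[cd_ord cd_less] fE.
have lineE : line_through a b = line_through c d.
  apply/setP => x; rewrite !inE; apply/idP/idP => xl.
    by have : f (a, b) (val x) by []; rewrite fE.
  by have : f (c, d) (val x) by []; rewrite -fE.
move: ab_ord; rewrite inE /= => /andP[ab /eqP card2].
have /andP[al bl] := line_through_ends ab.
have lab : line_through a b = [set a; b].
  apply/esym/eqP; rewrite eqEcard card2 cards2 ab andbT.
  by apply/fintype.subsetP => x; rewrite finset.in_set2 => /orP[]/eqP->.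
move: cd_ord; rewrite inE /= => /andP[cd _].
have := line_through_ends cd; rewrite -lineE lab !inE.
move: ab_less cd_less cd; rewrite !inE /=.
move=> ab_less cd_less cd /andP[/orP[]/eqP cE /orP[]/eqP dE];
  move: cd_less cd; rewrite cE dE ?eqxx //.
by move=> /ltn_trans/(_ ab_less); rewrite ltnn.
Qed.

End PointLines.

(** * Homogeneous coordinates and hyperplanes *)

Section HomogeneousCoordinates.
Variables (K : fieldType) (m : nat).
Let E := 'rV[K]_m.

(** The leading 1 turns affine dependencies of points into linear ones. *)
Definition homogeneous (x : E) : 'rV[K]_(1 + m) := row_mx 1%:M x.

(** Writing [c] as [(1 - t) a + t b] gives the coefficients [1 - t], [t] and [-1]; the first two are
    nonzero because [c] differs from [b] and from [a]. *)
Lemma homogeneous_dependency (V : {fset E}) (a b c : V) :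
  collinear_triple (@line_through _ _ V) a b c -> exists v : V -> K,
    (forall x, (v x != 0) = (x \in [set a; b; c])) /\
    forall i, \sum_x homogeneous (val x) 0 i * v x = 0.
Proof.
case/and4P=> ab ac bc; rewrite inE => /vlineP[t cE].
have {}cE : val c = (1 - t) *: val a + t *: val b.
  rewrite -[LHS](subrK (val a)) cE scalerBr scalerBl scale1r.
  by rewrite addrC addrA addrAC.
have t0 : t != 0.
  apply: contra_neq ac => t0; apply: val_inj.
  by rewrite cE t0 scale0r addr0 subr0 scale1r.
have t1 : 1 - t != 0.
  apply: contra_neq bc => /eqP; rewrite subr_eq0 => /eqP t1; apply: val_inj.
  by rewrite cE -t1 subrr scale0r add0r scale1r.
exists (fun x => (1 - t) * (x == a)%:R + t * (x == b)%:R - (x == c)%:R).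
split=> [x|i].
  rewrite !inE; have [->|xa] := eqVneq x a.
    by rewrite (negPf ab) (negPf ac) mulr1 mulr0 addr0 subr0 t1.
  have [->|xb] := eqVneq x b.
    by rewrite (negPf bc) mulr1 mulr0 add0r subr0 t0.
  rewrite !mulr0 add0r sub0r oppr_eq0.
  by case: (x == c); rewrite ?oner_eq0 ?eqxx.
pose M (x : V) := homogeneous (val x) 0 i.
transitivity (M a * (1 - t) + M b * t - M c).
  rewrite -(sum_delta (fun x => M x * (1 - t)) a).
  rewrite -(sum_delta (fun x => M x * t) b).
  rewrite -(sum_delta M c) -big_split -sumrB; apply: eq_bigr => x _ /=.
  by rewrite -/(M x) mulrBr mulrDr !mulrA.
rewrite /M /homogeneous !mxE; case: splitP => k _.
  by rewrite -mulrDr subrK mulr1 subrr.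
by rewrite cE !mxE ![_ * t]mulrC ![_ * (1 - t)]mulrC subrr.
Qed.

(** A nonzero left kernel vector is an affine function that vanishes at all the points. Its linear
    part [u] is nonzero, since a constant that vanishes somewhere is zero, so its zero set is a
    hyperplane. *)
Lemma affine_dependency_hyperplane (I : finType) (p : I -> E) (U : {set I}) :
  (0 < #|U|)%N ->
  ~~ row_free (\matrix_(i < 1 + m, j < #|U|) homogeneous (p (enum_val j)) 0 i) ->
  exists H : set E, affine_subspace m.-1 H /\ forall x, x \in U -> H (p x).
Proof.
move=> U0; rewrite -kermx_eq0 => /rowV0Pn[v /sub_kermxP vN v0].
pose v0' := lsubmx v; pose u : 'rV[K]_m := rsubmx v.
have vE x : x \in U -> v0' 0 0 + (p x *m u^T) 0 0 = 0.
  move=> xU; have := congr1 (fun A : 'rV_#|U| => A 0 (enum_rank_in xU x)) vN.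
  rewrite mxE [RHS]mxE big_split_ord big_ord1 /= => <-; congr (_ + _).
    by rewrite [LHS]mxE [X in _ * X]mxE enum_rankK_in // row_mxEl mxE mulr1.
  rewrite [LHS]mxE; apply: eq_bigr => k _.
  by rewrite [X in _ = _ * X]mxE enum_rankK_in // row_mxEr !mxE mulrC.
have [x0 x0U] : exists x, x \in U by apply/set0Pn; rewrite -card_gt0.
have u0 : u != 0.
  apply: contra_neq v0 => u0; rewrite -[v]hsubmxK -/u u0.
  have := vE x0 x0U; rewrite u0 trmx0 mulmx0 [X in _ + X]mxE addr0 => v00.
  have -> : lsubmx v = 0 by apply/matrixP => i j; rewrite !ord1 v00 mxE.
  by rewrite row_mx0.
pose f : 'Hom(E, 'rV[K]_1) := linfun (mulmxr u^T).
have fE x : f x = x *m u^T by rewrite lfunE.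
exists [set x : E | x - p x0 \in lker f]%classic; split.
  exists (p x0), (lker f); split=> //.
  have := limg_ker_dim f fullv; rewrite capfv dimvf /dim /= mul1n.
  suff -> : \dim (limg f) = 1%N by rewrite addn1 => /(congr1 predn).
  apply/eqP; rewrite eqn_leq; apply/andP; split.
    by rewrite (leq_trans (dimvS (subvf _))) // dimvf /dim /= mul1n.
  rewrite lt0n dimv_eq0; have /rV0Pn[i ui] := u0.
  apply/eqP => f0; have : f (delta_mx 0 i) \in limg f by rewrite memv_img ?memvf.
  rewrite f0 memv0 fE => /eqP/matrixP/(_ 0 0); rewrite -rowE.
  rewrite [LHS]mxE [LHS]mxE [RHS]mxE => /eqP.
  by rewrite (negPf ui).
move=> x xU /=; rewrite memv_ker fE mulmxBl; apply/eqP/matrixP => i j.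
rewrite !ord1 [RHS]mxE [LHS]mxE [X in _ + X]mxE.
by have /addrI-> := etrans (vE x xU) (esym (vE x0 x0U)); rewrite subrr.
Qed.

End HomogeneousCoordinates.

(** * The count of ordinary lines in complex 4-space *)

Theorem theorem1p10 (R : realType) :
  exists n0 : nat, (0 < n0)%N /\
    forall (n : nat) (V : {fset 'rV[R[i]]_4}),
      (n0 <= n)%N ->
      #|` V| = n ->
      (forall H : set 'rV[R[i]]_4, affine_subspace 3 H ->
         (#|` points_in V H|)%:R <= 2 / 3 * n%:R :> R) ->
      1 / 12 * n%:R ^+ 2 <= (t2 V)%:R :> R.
Proof.
(* From 30 on, [n <= n ^ 2 / 30], so the lower bound [n ^ 2 / 5 - n] for twice the number of
   ordinary lines is at least [n ^ 2 / 6]. *)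
exists 30; split=> // n V n30 Vn hyp.
have cardV : #|{: V}| = n by rewrite -Vn cardfE.
have n30R : 30 <= n%:R :> R by rewrite (ler_nat R 30).
have [||U [U0 dense rank]] := @densest_subset_bound R V (@line_through _ _ V)
  (@line_through_ends _ _ V) (@line_through_eq _ _ V) (1 + 4)
  (fun x i => homogeneous (val x) 0 i).
- by rewrite cardV (leq_trans _ n30).
- by move=> a b c abc; apply: homogeneous_dependency.
rewrite cardV in dense.
have U0R : 0 < #|U|%:R :> R by rewrite ltr0n.
have Un : #|U|%:R <= n%:R :> R by rewrite ler_nat -cardV max_card.
set W := weight_in R _ [set: V] in dense.
(* Every ordered pair of distinct points that is not ordinary contributes exactly 1 to the total
   weight. *)
have WE : n%:R ^+ 2 - n%:R - (#|ordinary_pairs V|)%:R <= W.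
  rewrite /W weight_in_setT; last exact: line_through_ends.
  have -> : (#|ordinary_pairs V|)%:R =
      \sum_a \sum_b ((a, b) \in ordinary_pairs V)%:R :> R.
    rewrite pair_bigA /= -sum1_card natr_sum big_mkcond /=.
    by apply: eq_bigr => -[a b] _; case: ifP.
  have diagE (a : V) : \sum_b (a == b)%:R = 1 :> R.
    rewrite -[RHS](sum_delta (fun=> 1) a).
    by apply: eq_bigr => b _; rewrite mul1r eq_sym.
  have <- : \sum_(a : V) \sum_(b : V) (1 - (a == b)%:R) = n%:R ^+ 2 - n%:R :> R.
    under eq_bigr do rewrite sumrB diagE sumr_const cardV.
    by rewrite sumr_const cardV mulrnBl -natrX -mulnn -mulrnA.
  rewrite -sumrB ler_sum // => a _; rewrite -sumrB ler_sum // => b _.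
  rewrite inE /=; have [->|ab] /= := eqVneq a b; first by rewrite !subrr.
  have : (2 <= #|line_through a b|)%N.
    have /andP[al bl] := line_through_ends ab.
    apply: (@leq_trans #|[set a; b]|); first by rewrite cards2 ab.
    apply/subset_leq_card/fintype.subsetP => x.
    by rewrite finset.in_set2 => /orP[]/eqP->.
  by rewrite leq_eqVlt eq_sym; case: eqP => /= [_ _|_ ->];
    rewrite subr0 ?subrr ?subr0.
have t2E : (#|ordinary_pairs V|)%:R <= 2 * (t2 V)%:R :> R.
  by rewrite -natrM ler_nat card_ordinary_pairs_le.
suff : W <= 4 / 5 * n%:R ^+ 2 by nra.
rewrite -(ler_pM2r U0R); apply: le_trans dense _.
have -> : 4 / 5 * n%:R ^+ 2 * #|U|%:R = 4 / 5 * n%:R * #|U|%:R * n%:R :> R.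
  by ring.
rewrite ler_wpM2r //.
(* If [U] spans affinely, its weight is at most [4 / 5] of [|U| ^ 2] because there are 5 homogeneous
   coordinates. Otherwise [U] lies in a hyperplane, hence has at most [2 / 3 * n] points, and the
   trivial bound [|U| ^ 2] suffices. *)
have [Nfree|Ndep] := boolP (row_free (\matrix_(i < 1 + 4, j < #|U|)
  homogeneous (val (enum_val j : V)) 0 i)).
  have := rank Nfree; have := ler_wpM2l (ltW U0R) Un.
  rewrite -[(1 + 4)%N]/5%N; nra.
have [H [H3 UH]] := affine_dependency_hyperplane U0 Ndep.
have U23 : #|U|%:R <= 2 / 3 * n%:R :> R.
  apply: le_trans (hyp H H3); rewrite ler_nat; exact: points_in_card_ge.
have := weight_in_le R (@line_through_ends _ _ V) U; nra.
Qed.
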